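(* Let $\mathcal{A}=(a_{\mathbf{i},\mathbf{j}})\in\mathbb{C}^{\mathbf{I}(N)\times\mathbf{I}(N)}$ be strictly diagonally dominant and let $\mathcal{B}\in\mathbb{C}^{\mathbf{I}(N)}$. Write $\mathcal{A}=\mathcal{L}+\mathcal{D}+\mathcal{U}$ with $\mathcal{L}$, $\mathcal{D}$, $\mathcal{U}$ the lower off-diagonal, diagonal and upper off-diagonal parts of $\mathcal{A}$. Then the Gauss-Seidel iteration scheme $$\mathcal{X}^{(k+1)}=-(\mathcal{D}+\mathcal{L})^{-1}*_N\mathcal{U}*_N\mathcal{X}^{(k)}+(\mathcal{D}+\mathcal{L})^{-1}*_N\mathcal{B},\qquad k=0,1,2,\dots$$ converges for any initial tensor $\mathcal{X}^{(0)}\in\mathbb{C}^{\mathbf{I}(N)}$.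
   Context: For positive integers $I_1,\dots,I_N$ write $\mathbf{I}(N)=I_1\times\cdots\times I_N$; multi-indices are $\mathbf{i}=(i_1,\dots,i_N)$ with $1\le i_s\le I_s$. $\mathbb{C}^{\mathbf{I}(N)\times\mathbf{I}(N)}$ is the set of complex tensors with entries $a_{\mathbf{i},\mathbf{j}}=a_{i_1\dots i_N j_1\dots j_N}$. The Einstein product is $(\mathcal{A}*_N\mathcal{B})_{\mathbf{i},\mathbf{j}}=\sum_{\mathbf{k}}a_{\mathbf{i},\mathbf{k}}b_{\mathbf{k},\mathbf{j}}$, and for $\mathcal{X}\in\mathbb{C}^{\mathbf{I}(N)}$, $(\mathcal{A}*_N\mathcal{X})_{\mathbf{i}}=\sum_{\mathbf{k}}a_{\mathbf{i},\mathbf{k}}x_{\mathbf{k}}$; inverses are with respect to $*_N$. $\mathcal{A}$ is strictly diagonally dominant if $|a_{\mathbf{i},\mathbf{i}}|>\sum_{\mathbf{j}\ne\mathbf{i}}|a_{\mathbf{i},\mathbf{j}}|$ for every multi-index $\mathbf{i}$. Fix the linear order $\prec$ on multi-indices, from $(1,\dots,1)$ to $(I_1,\dots,I_N)$, in which the Gauss-Seidel sweep runs through them (for instance the lexicographic order). The diagonal part $\mathcal{D}$ keeps the entries $a_{\mathbf{i},\mathbf{i}}$, the lower off-diagonal part $\mathcal{L}$ keeps the entries $a_{\mathbf{i},\mathbf{j}}$ with $\mathbf{j}\prec\mathbf{i}$, and the upper off-diagonal part $\mathcal{U}$ keeps the entries $a_{\mathbf{i},\mathbf{j}}$ with $\mathbf{i}\prec\mathbf{j}$;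 all other entries of each are zero. Convergence is entrywise. *)

(* Defs.v *)
From mathcomp Require Import all_boot all_order all_algebra.
From mathcomp Require Import all_classical all_reals all_analysis.
From mathcomp Require Export complex.

Set Implicit Arguments.
Unset Strict Implicit.
Unset Printing Implicit Defensive.

Import Order.TTheory GRing.Theory Num.Theory.
Import numFieldNormedType.Exports.
Local Open Scope classical_set_scope.
Local Open Scope ring_scope.

(* Coordinates are 0-based: position s ranges over 0, ..., I s - 1. *)
Definition midx (N : nat) (I : 'I_N -> nat) : finType :=
  {dffun forall s : 'I_N, 'I_(I s)}.

Notation vtensor R I := {ffun midx I -> R[i]}.
Notation tensor R I := {ffun midx I * midx I -> R[i]}.

Section Tensors.
Variables (R : realType) (N : nat) (I : 'I_N -> nat).
Local Notation idx := (midx I).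
Local Notation vtensor := (vtensor R I).
Local Notation tensor := (tensor R I).

Definition einstein (A B : tensor) : tensor :=
  [ffun ij : idx * idx => \sum_(k : idx) A (ij.1, k) * B (k, ij.2)].

Definition einstein_vec (A : tensor) (X : vtensor) : vtensor :=
  [ffun i : idx => \sum_(k : idx) A (i, k) * X k].

Definition tensor_id : tensor :=
  [ffun ij : idx * idx => (ij.1 == ij.2)%:R].

Definition is_einv (A T : tensor) : Prop :=
  einstein A T = tensor_id /\ einstein T A = tensor_id.

Definition einvertible (A : tensor) : Prop := exists T : tensor, is_einv A T.

(* Junk value 0 when A is not invertible. *)
Definition einv (A : tensor) : tensor := xget 0 [set T | is_einv A T].

Definition strictly_diag_dominant (A : tensor) : Prop :=
  forall i : idx, \sum_(j : idx | j != i) `|A (i, j)| < `|A (i, i)|.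

Definition sweep_order (prec : rel idx) : Prop :=
  [/\ irreflexive prec, transitive prec,
      (forall i j : idx, i != j -> prec i j || prec j i),
      (forall i j : idx, (forall s, i s = 0%N :> nat) -> j != i -> prec i j)
    & (forall i j : idx,
        (forall s, i s = (I s).-1 :> nat) -> j != i -> prec j i)].

Definition diag_part (A : tensor) : tensor :=
  [ffun ij : idx * idx => if ij.1 == ij.2 then A ij else 0].

Definition lower_part (prec : rel idx) (A : tensor) : tensor :=
  [ffun ij : idx * idx => if prec ij.2 ij.1 then A ij else 0].

Definition upper_part (prec : rel idx) (A : tensor) : tensor :=
  [ffun ij : idx * idx => if prec ij.1 ij.2 then A ij else 0].

Definition gs_step (prec : rel idx) (A : tensor) (B X : vtensor) : vtensor :=
  let DLinv := einv (diag_part A + lower_part prec A) in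
  - einstein_vec (einstein DLinv (upper_part prec A)) X
  + einstein_vec DLinv B.

Definition gs_iter (prec : rel idx) (A : tensor) (B X0 : vtensor) (k : nat)
    : vtensor :=
  iter k (gs_step prec A B) X0.

(* (R[i])^o carries the topology of the complex modulus; R[i] itself has none. *)
Definition entrywise_cvg (X : nat -> vtensor) (L : vtensor) : Prop :=
  forall i : idx, (fun k : nat => X k i : (R[i])^o) @ \oo --> (L i : (R[i])^o).

End Tensors.

(* Main.v *)
Require Import Defs.
From mathcomp Require Import all_boot all_order all_algebra.
From mathcomp Require Import all_classical all_reals all_analysis.

(** If [L] solves [A L = B], the error [e_k = X^(k) - L] satisfies
    [(D + L) e_(k+1) = - U e_k].  Strict dominance gives [t < 1] with
    [sum_(j > i) |a_ij| <= t (|a_ii| - sum_(j < i) |a_ij|)] for all [i];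
    reading the [i]-th equation at an index where [|e_(k+1)|] is maximal yields
    [max |e_(k+1)| <= t max |e_k|].  The same maximality argument shows that
    strictly dominant tensors are injective on vectors, hence invertible. *)

Set Implicit Arguments.
Unset Strict Implicit.
Unset Printing Implicit Defensive.

Import Order.TTheory GRing.Theory Num.Theory.
Import numFieldNormedType.Exports.
Local Open Scope classical_set_scope.
Local Open Scope ring_scope.
Local Open Scope complex_scope.

(** The order of [F] may be partial, but norms are real, hence pairwise comparable, so a maximum
    over a finite type exists; [i0] witnesses nonemptiness. *)
Lemma exists_max_norm (F : numDomainType) (T : finType) (i0 : T) (f : T -> F) :
  exists i, forall j, `|f j| <= `|f i|.
Proof.
have [|i _ imax] := @real_arg_maxP F T i0 xpredT (fun i => `|f i|) isT.
  by move=> i _; exact: normr_real.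
by exists i => j; exact: imax.
Qed.

(** * Scalar row estimates for one Gauss-Seidel sweep *)

Section GaussSeidelContraction.
Variables (F : numFieldType) (T : finType) (i0 : T) (prec : rel T).
Variable a : T -> T -> F.
Local Notation low i := (\sum_(j | prec j i) `|a i j|).
Local Notation up i := (\sum_(j | prec i j) `|a i j|).

(** The rate is the largest ratio of [up i] to the gap between [|a i i|] and [low i]; dominance
    makes each gap positive and each ratio less than 1. *)
Lemma gs_rate : (forall i, low i + up i < `|a i i|) ->
  exists2 t : F, 0 <= t < 1 & forall i, up i <= t * (`|a i i| - low i).
Proof.
move=> dom.
have gap_gt0 i : 0 < `|a i i| - low i.
  rewrite subr_gt0; apply: le_lt_trans (dom i).
  by rewrite lerDl; apply: sumr_ge0 => j _; exact: normr_ge0.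
pose r i : F := up i / (`|a i i| - low i).
have r_ge0 i : 0 <= r i.
  rewrite /r ler_pdivlMr// mul0r.
  by apply: sumr_ge0 => j _; exact: normr_ge0.
have [i rmax] := exists_max_norm i0 r.
exists (r i).
  by rewrite r_ge0 andTb ltr_pdivrMr ?gap_gt0 ?mul1r ?ltrBrDl ?dom.
move=> j; rewrite -ler_pdivrMr//.
by have := rmax j; rewrite (ger0_norm (r_ge0 j)) (ger0_norm (r_ge0 i)).
Qed.

Lemma gs_contraction (t M : F) (x y : T -> F) :
    (forall i, low i + up i < `|a i i|) ->
    (forall i, up i <= t * (`|a i i| - low i)) ->
    (forall i, a i i * y i + \sum_(j | prec j i) a i j * y j
               = - \sum_(j | prec i j) a i j * x j) ->
    0 <= M -> (forall j, `|x j| <= M) ->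
  forall i, `|y i| <= t * M.
Proof.
move=> dom upt eqn M_ge0 xM i.
have [m ymax] := exists_max_norm i0 y.
apply: le_trans (ymax i) _.
have gap_gt0 : 0 < `|a m m| - low m.
  rewrite subr_gt0; apply: le_lt_trans (dom m).
  by rewrite lerDl; apply: sumr_ge0 => j _; exact: normr_ge0.
(* Both sides are scaled by the gap of row [m]. In that row the lower terms cost at most
   [low m * |y m|], by maximality of [|y m|], and are absorbed on the left. *)
rewrite -(ler_pM2l gap_gt0).
have row : a m m * y m = - \sum_(j | prec m j) a m j * x j
                         - \sum_(j | prec j m) a m j * y j.
  by rewrite -eqn addrK.
have lowy : `|\sum_(j | prec j m) a m j * y j| <= low m * `|y m|.
  rewrite mulr_suml; apply: le_trans (ler_norm_sum _ _ _) _.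
  by apply: ler_sum => j _; rewrite normrM ler_wpM2l.
have upx : `|\sum_(j | prec m j) a m j * x j| <= up m * M.
  rewrite mulr_suml; apply: le_trans (ler_norm_sum _ _ _) _.
  by apply: ler_sum => j _; rewrite normrM ler_wpM2l.
have {}row : `|a m m| * `|y m| <= up m * M + low m * `|y m|.
  rewrite -normrM row; apply: le_trans (ler_normB _ _) _.
  by rewrite normrN lerD.
rewrite mulrBl lerBlDr; apply: le_trans row _.
by rewrite lerD2r mulrCA mulrA ler_wpM2r.
Qed.

End GaussSeidelContraction.

(** * Algebra of the Einstein product and invertibility *)

Section EinsteinProduct.
Variables (R : realType) (N : nat) (I : 'I_N -> nat).
Implicit Types (A B : tensor R I) (X Y : vtensor R I).

Lemma einstein_vecDl A B X :
  einstein_vec (A + B) X = einstein_vec A X + einstein_vec B X.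
Proof.
apply/ffunP => i; rewrite !ffunE -big_split; apply: eq_bigr => k _ /=.
by rewrite ffunE mulrDl.
Qed.

Lemma einstein_vecD A X Y :
  einstein_vec A (X + Y) = einstein_vec A X + einstein_vec A Y.
Proof.
apply/ffunP => i; rewrite !ffunE -big_split; apply: eq_bigr => k _ /=.
by rewrite ffunE mulrDr.
Qed.

Lemma einstein_vecN A X : einstein_vec A (- X) = - einstein_vec A X.
Proof.
apply/ffunP => i; rewrite !ffunE -sumrN; apply: eq_bigr => k _.
by rewrite ffunE mulrN.
Qed.

Lemma einstein_vecB A X Y :
  einstein_vec A (X - Y) = einstein_vec A X - einstein_vec A Y.
Proof. by rewrite einstein_vecD einstein_vecN. Qed.

Lemma einstein_vecA A B X :
  einstein_vec (einstein A B) X = einstein_vec A (einstein_vec B X).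
Proof.
apply/ffunP => i; rewrite !ffunE.
under eq_bigr => k _ do rewrite ffunE /= mulr_suml.
rewrite exchange_big; apply: eq_bigr => k _ /=.
by rewrite ffunE mulr_sumr; apply: eq_bigr => j _; rewrite mulrA.
Qed.

Lemma einstein_vec1 X : einstein_vec (tensor_id R I) X = X.
Proof.
apply/ffunP => i; rewrite ffunE (bigD1 i)//= ffunE /= eqxx mul1r.
by rewrite big1 ?addr0// => k ki; rewrite ffunE /= eq_sym (negPf ki) mul0r.
Qed.

(** Enumerating the multi-indices flattens [A] to a square matrix [M]; a trivial kernel makes its
    determinant nonzero, and the matrix inverse is folded back into a tensor. *)
Lemma einstein_inj_einvertible A :
  (forall X, einstein_vec A X = 0 -> X = 0) -> einvertible A.
Proof.
move=> Ainj.
pose M := \matrix_(i < #|midx I|, j < #|midx I|) A (enum_val i, enum_val j).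
have Mu : M \in unitmx.
  (* [det0P] yields a row vector killed from the left, so it is applied to the transpose of [M] to
     obtain a kernel vector of [A]. *)
  rewrite unitmxE -det_tr unitfE; apply/negP => /det0P[v v0 vM].
  pose X : vtensor R I := [ffun k => v 0 (enum_rank k)].
  suff X0 : X = 0.
    case/eqP: v0; apply/rowP => j; rewrite mxE.
    by have /ffunP/(_ (enum_val j)) := X0; rewrite !ffunE enum_valK.
  apply: Ainj; apply/ffunP => i; rewrite !ffunE.
  have /rowP/(_ (enum_rank i)) := vM; rewrite !mxE => vMi; rewrite -[RHS]vMi.
  rewrite [RHS](reindex _ (onW_bij _ (@enum_rank_bij (midx I)))) /=.
  by apply: eq_bigr => k _; rewrite !mxE !ffunE !enum_rankK mulrC.
pose S : tensor R I := [ffun ij => invmx M (enum_rank ij.1) (enum_rank ij.2)].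
exists S; split; apply/ffunP => -[i j]; rewrite !ffunE /=.
- have /matrixP/(_ (enum_rank i) (enum_rank j)) := mulmxV Mu.
  rewrite !mxE (inj_eq enum_rank_inj) => <-.
  rewrite [RHS](reindex _ (onW_bij _ (@enum_rank_bij (midx I)))) /=.
  by apply: eq_bigr => k _; rewrite !mxE !ffunE /= !enum_rankK.
- have /matrixP/(_ (enum_rank i) (enum_rank j)) := mulVmx Mu.
  rewrite !mxE (inj_eq enum_rank_inj) => <-.
  rewrite [RHS](reindex _ (onW_bij _ (@enum_rank_bij (midx I)))) /=.
  by apply: eq_bigr => k _; rewrite !mxE !ffunE /= !enum_rankK.
Qed.

Lemma einvP A : einvertible A -> is_einv A (einv A).
Proof. exact: xgetPex. Qed.

End EinsteinProduct.

(** * The splitting of [A] along the sweep order *)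

Section Splitting.
Variables (R : realType) (N : nat) (I : 'I_N -> nat) (prec : rel (midx I)).
Variable A : tensor R I.
Hypothesis prec_sweep : sweep_order prec.
Local Notation DL := (diag_part A + lower_part prec A).
Local Notation U := (upper_part prec A).

Lemma sweep_order_asym i j : prec i j -> ~~ prec j i.
Proof.
have [irr tr _ _ _] := prec_sweep.
by move=> ij; apply/negP => /(tr _ _ _ ij); rewrite irr.
Qed.

Lemma sum_sweep (V : zmodType) (f : midx I -> V) i :
  \sum_(j | j != i) f j = \sum_(j | prec j i) f j + \sum_(j | prec i j) f j.
Proof.
have [irr _ tot _ _] := prec_sweep.
rewrite (bigID (fun j => prec j i)) /=; congr (_ + _); apply: eq_bigl => j.
  by case: eqP => [->|]; rewrite ?irr.
have [->|ji] := eqVneq j i; first by rewrite irr.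
have := tot _ _ ji; case: (boolP (prec j i)) => [/sweep_order_asym/negPf->|] //=.
Qed.

Lemma splitting : A = DL + U.
Proof.
have [irr _ tot _ _] := prec_sweep.
apply/ffunP => -[i j]; rewrite !ffunE /=.
have [<-|ij] := eqVneq i j; first by rewrite irr !addr0.
have := tot _ _ ij; have := @sweep_order_asym i j.
by case: (prec i j); case: (prec j i) => /=; rewrite ?add0r ?addr0 // => /(_ isT).
Qed.

Lemma einstein_vec_DL X i : einstein_vec DL X i
  = A (i, i) * X i + \sum_(j | prec j i) A (i, j) * X j.
Proof.
rewrite einstein_vecDl !ffunE; congr (_ + _).
  rewrite (bigD1 i)//= ffunE /= eqxx big1 ?addr0// => j ji.
  by rewrite ffunE /= eq_sym (negPf ji) mul0r.
rewrite [RHS]big_mkcond; apply: eq_bigr => j _; rewrite ffunE /=.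
by case: ifP; rewrite ?mul0r.
Qed.

Lemma einstein_vec_U X i :
  einstein_vec U X i = \sum_(j | prec i j) A (i, j) * X j.
Proof.
rewrite ffunE [RHS]big_mkcond; apply: eq_bigr => j _; rewrite ffunE /=.
by case: ifP; rewrite ?mul0r.
Qed.

(** The relation between [X] and [Y] is kept implicit, without inverting [DL], so that invertibility
    can itself be deduced from the bound. The rate [t] is chosen before [X] and [Y], hence serves
    every iteration. *)
Lemma sdd_gs_contraction (i0 : midx I) : strictly_diag_dominant A ->
  exists2 t : R[i], 0 <= t < 1 & forall (M : R[i]) (X Y : vtensor R I),
    einstein_vec DL Y = - einstein_vec U X -> 0 <= M ->
    (forall j, `|X j| <= M) -> forall i, `|Y i| <= t * M.
Proof.
move=> Asdd; pose a i j := A (i, j).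
have dom i : \sum_(j | prec j i) `|a i j| + \sum_(j | prec i j) `|a i j|
             < `|a i i|.
  by rewrite -sum_sweep.
have [t t01 upt] := gs_rate i0 dom.
exists t => // M X Y /ffunP eqn M_ge0 XM.
apply: (gs_contraction i0 dom upt _ M_ge0 XM) => i.
have := eqn i; rewrite einstein_vec_DL => ->.
by rewrite -einstein_vec_U ffunE.
Qed.

(** A kernel vector of [DL] is the outcome of a sweep started at 0, so the contraction with [M = 0]
    forces it to vanish. *)
Lemma DL_einvertible (i0 : midx I) :
  strictly_diag_dominant A -> einvertible DL.
Proof.
move=> /(sdd_gs_contraction i0)[t _ contr].
apply: einstein_inj_einvertible => Y Y0; apply/ffunP => i; rewrite ffunE.
have U0 : einstein_vec U 0 = 0.
  by apply/ffunP => j; rewrite !ffunE big1// => k _; rewrite !ffunE mulr0.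
have := contr 0 0 Y _ (lexx 0) _ i; rewrite mulr0 normr_le0 => Yi.
apply/eqP/Yi; first by rewrite Y0 U0 oppr0.
by move=> j; rewrite ffunE normr0.
Qed.

(** A kernel vector [Y] of [A] is reproduced by the homogeneous sweep, so its largest modulus is at
    most [t] times itself with [t < 1]. *)
Lemma sdd_einvertible (i0 : midx I) :
  strictly_diag_dominant A -> einvertible A.
Proof.
move=> /(sdd_gs_contraction i0)[t /andP[_ t1] contr].
apply: einstein_inj_einvertible => Y; rewrite {1}splitting einstein_vecDl.
move=> /eqP; rewrite addr_eq0 => /eqP Y0.
have [m Ymax] := exists_max_norm i0 Y.
have Ym := contr _ _ _ Y0 (normr_ge0 _) Ymax m.
have {}Ym : `|Y m| <= 0.
  rewrite -(@pmulr_rle0 _ (1 - t)) ?subr_gt0//.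
  by rewrite mulrBl mul1r subr_le0.
apply/ffunP => i; rewrite ffunE; apply/eqP; rewrite -normr_le0.
exact: le_trans (Ymax i) Ym.
Qed.

(** Applying [DL] to the step gives [B - U X], while [DL L = B - U L]; the difference no longer
    contains [B]. *)
Lemma gs_step_error B X L : einvertible DL -> einstein_vec A L = B ->
  einstein_vec DL (gs_step prec A B X - L) = - einstein_vec U (X - L).
Proof.
move=> /einvP[DLV _]; rewrite {1}splitting einstein_vecDl => <-.
rewrite /gs_step !einstein_vecB !einstein_vecD !einstein_vecN !einstein_vecA.
rewrite -!(einstein_vecA DL) DLV !einstein_vec1.
by rewrite opprB [RHS]addrC -addrA (addrAC (einstein_vec DL L)) subrr add0r.
Qed.

End Splitting.

Lemma geometric_cvg_complex (R : realType) (x : nat -> R[i]) (l t M : R[i]) :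
    0 <= t < 1 -> 0 <= M -> (forall k, `|x k - l| <= t ^+ k * M) ->
  (fun k => x k : (R[i])^o) @ \oo --> (l : (R[i])^o).
Proof.
(* Comparability with 0 forces the imaginary parts of [t], [M] and, below, of the radius to vanish,
   which leaves a real geometric sequence. *)
case: t => t u; case: M => M v; rewrite lecE ltcE /=.
move=> /andP[/andP[/eqP-> t0] /andP[_ t1]] /andP[/eqP-> M0] xl.
apply/cvgrPdist_lt => -[e w]; rewrite ltcE /= => /andP[/eqP-> e0].
have tM0 : geometric M t @ \oo --> 0 by apply: cvg_geometric; rewrite ger0_norm.
have /cvgrPdist_lt/(_ _ e0) := tM0; apply: filterS => k.
rewrite sub0r normrN distrC => tMe.
apply: le_lt_trans (xl k) _.
rewrite -[t +i* 0]/(t%:C) -[M +i* 0]/(M%:C) -[e +i* 0]/(e%:C).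
rewrite -rmorphXn -rmorphM ltcR mulrC.
exact: le_lt_trans (ler_norm _) tMe.
Qed.

Theorem theorem5p13 (R : realType) (N : nat) (I : 'I_N -> nat)
    (N_gt0 : (0 < N)%N) (I_gt0 : forall s : 'I_N, (0 < I s)%N)
    (prec : rel (midx I)) (prec_sweep : sweep_order prec)
    (A : tensor R I) (B : vtensor R I)
    (A_sdd : strictly_diag_dominant A) :
  einvertible (diag_part A + lower_part prec A)%R /\
  forall X0 : vtensor R I,
    exists L : vtensor R I, entrywise_cvg (gs_iter prec A B X0) L.
Proof.
pose i0 : midx I := [ffun s => Ordinal (I_gt0 s)].
have DLu := DL_einvertible prec_sweep i0 A_sdd.
split=> // X0.
have [T [AT _]] := sdd_einvertible prec_sweep i0 A_sdd.
(* The limit is the solution of the linear system, the same for every [X0]. *)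
pose L := einstein_vec T B.
have AL : einstein_vec A L = B by rewrite -einstein_vecA AT einstein_vec1.
have [t t01 contr] := sdd_gs_contraction prec_sweep i0 A_sdd.
have [m emax] := exists_max_norm i0 (X0 - L).
exists L => i; apply: (geometric_cvg_complex t01 (normr_ge0 ((X0 - L) m))) => k.
(* The induction must bound all entries at once, since the contraction takes a uniform bound as
   input. *)
suff : forall j, `|(gs_iter prec A B X0 k - L) j| <= t ^+ k * `|(X0 - L) m|.
  by move=> /(_ i); rewrite !ffunE.
elim: k => [|k IH] j; first by rewrite expr0 mul1r; exact: emax.
rewrite exprS -mulrA; apply: contr IH j; first exact: gs_step_error.
by rewrite mulr_ge0 ?exprn_ge0//; case/andP: t01.
Qed.
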